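(* Let $z^n=[u^n\ v^n\ \zeta_1^n\ \zeta_2^n]^\top$ be given by the Crank–Nicolson scheme (as defined in the context). For $n\in\mathbb{N}_0$ it holds for the norm $\|\cdot\|$ defined in the context: $$\|z^{n+1}\|^2=\|z^n\|^2-\Delta t\Bigg\{\delta_1\left(\frac{u^{n+1}_x(L)-u^n_x(L)}{\Delta t}\right)^2+\frac12\left(q_1\cdot\frac{\zeta_1^{n+1}+\zeta_1^n}{2}+\tilde\delta_1\frac{u^{n+1}_x(L)-u^n_x(L)}{\Delta t}\right)^2$$ $$+\delta_2\left(\frac{u^{n+1}(L)-u^n(L)}{\Delta t}\right)^2+\frac12\left(q_2\cdot\frac{\zeta_2^{n+1}+\zeta_2^n}{2}+\tilde\delta_2\frac{u^{n+1}(L)-u^n(L)}{\Delta t}\right)^2$$ $$+\frac{\epsilon_1}{2}\frac{(\zeta_1^{n+1}+\zeta_1^n)^\top}{2}P_1\frac{\zeta_1^{n+1}+\zeta_1^n}{2}+\frac{\epsilon_2}{2}\frac{(\zeta_2^{n+1}+\zeta_2^n)^\top}{2}P_2\frac{\zeta_2^{n+1}+\zeta_2^n}{2}\Bigg\}.$$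
   Context: Coefficients. Fix $L>0$, an integer $r\ge1$, constants $M,J,k_1,k_2>0$, and strictly positive functions $\mu,\Lambda\in C^4[0,L]$. For $j=1,2$ let $A_j\in\mathbb{R}^{r\times r}$ be Hurwitz (all eigenvalues have negative real part), $b_j,c_j\in\mathbb{R}^r$, and $d_j,\delta_j\in\mathbb{R}$ such that the transfer function $\mathcal{G}_j(s)=\big((s\,\mathrm{Id}-A_j)^{-1}b_j\big)\cdot c_j+d_j$ satisfies $\operatorname{Re}\mathcal{G}_j(i\omega)\ge d_j\ge\delta_j>0$ for all $\omega\ge0$. Fix symmetric positive definite matrices $P_j\in\mathbb{R}^{r\times r}$, scalars $\epsilon_j>0$ and vectors $q_j\in\mathbb{R}^r$ (existing by the Kalman–Yakubovich–Popov lemma) with $P_jA_j+A_j^\top P_j=-q_jq_j^\top-\epsilon_jP_j$ and $P_jb_j=c_j-q_j\sqrt{2(d_j-\delta_j)}$, $j=1,2$. Set $\tilde\delta_j=\sqrt{2(d_j-\delta_j)}$. Discrete space. Let $W_h\subset\tilde H^2_0(0,L):=\{u\in H^2(0,L):u(0)=u_x(0)=0\}$ be a finite dimensional subspace (any choice is allowed) with basis $w_1,\dots,w_N$. Define for $i,j=1,\dots,N$ $\mathbb{A}_{i,j}=\int_0^L\mu w_iw_j\,dx+Mw_i(L)w_j(L)+J(w_i)_x(L)(w_j)_x(L)$, $\mathbb{B}_{i,j}=d_1(w_i)_x(L)(w_j)_x(L)+d_2w_i(L)w_j(L)$, $\mathbb{K}_{i,j}=\int_0^L\Lambda(w_i)_{xx}(w_j)_{xx}\,dx+k_1(w_i)_x(L)(w_j)_x(L)+k_2w_i(L)w_j(L)$.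 Crank–Nicolson scheme. Let $\Delta t>0$ be the time step. The discrete solution at $t_n=n\Delta t$ is $z^n=[u^n\ v^n\ \zeta_1^n\ \zeta_2^n]^\top$ with $u^n,v^n\in W_h$, $\zeta_1^n,\zeta_2^n\in\mathbb{R}^r$; $\mathbb{U}^n,\mathbb{V}^n\in\mathbb{R}^N$ are the coefficient vectors of $u^n,v^n$ in the basis $\{w_j\}$, and $(\mathbb{C}^n)_j:=c_1\cdot\zeta_1^n\,(w_j)_x(L)+c_2\cdot\zeta_2^n\,w_j(L)$. Given $z^n$, $z^{n+1}$ is determined by $$\frac{\mathbb{U}^{n+1}-\mathbb{U}^n}{\Delta t}=\frac12(\mathbb{V}^{n+1}+\mathbb{V}^n),$$ $$\frac{\mathbb{A}\mathbb{V}^{n+1}-\mathbb{A}\mathbb{V}^n}{\Delta t}=-\frac12(\mathbb{K}\mathbb{U}^{n+1}+\mathbb{K}\mathbb{U}^n)-\frac12(\mathbb{B}\mathbb{V}^{n+1}+\mathbb{B}\mathbb{V}^n)-\frac12(\mathbb{C}^{n+1}+\mathbb{C}^n),$$ $$\frac{\zeta_1^{n+1}-\zeta_1^n}{\Delta t}=A_1\frac{\zeta_1^{n+1}+\zeta_1^n}{2}+b_1\frac{v^{n+1}_x(L)+v^n_x(L)}{2},$$ $$\frac{\zeta_2^{n+1}-\zeta_2^n}{\Delta t}=A_2\frac{\zeta_2^{n+1}+\zeta_2^n}{2}+b_2\frac{v^{n+1}(L)+v^n(L)}{2}.$$ Norm. For $z=[u\ v\ \zeta_1\ \zeta_2]^\top$,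 $$\|z\|^2:=\frac12\int_0^L\Lambda u_{xx}^2\,dx+\frac12\int_0^L\mu v^2\,dx+\frac M2v(L)^2+\frac J2v_x(L)^2+\frac{k_1}2u_x(L)^2+\frac{k_2}2u(L)^2+\frac12\zeta_1^\top P_1\zeta_1+\frac12\zeta_2^\top P_2\zeta_2.$$ *)

(* Defs.v *)
From HB Require Import structures.
From mathcomp Require Import all_boot all_order all_algebra.
From mathcomp Require Import all_classical all_reals all_analysis.
From mathcomp Require Import complex.

Set Implicit Arguments.
Unset Strict Implicit.
Unset Printing Implicit Defensive.

Import Order.TTheory GRing.Theory Num.Theory.
Import numFieldNormedType.Exports.

Local Open Scope classical_set_scope.
Local Open Scope complex_scope.
Local Open Scope ring_scope.

Section FunctionSpaces.
Variables (R : realType) (L : R).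
Implicit Types (f g u phi : R -> R).

(* Functions on (0, L) or [0, L] are represented by total functions R -> R
   whose values elsewhere are irrelevant. *)

(* f \in C^k[0, L]: all derivatives up to order k exist on (0, L) and extend
   continuously to [0, L]; D i is the extension of the i-th derivative. *)
Definition Ck_itv (k : nat) f : Prop :=
  exists D : nat -> R -> R,
    [/\ {in `[0, L], f =1 D 0%N},
        forall i, (i <= k)%N -> {within `[0, L], continuous (D i)} &
        forall i, (i < k)%N -> {in `]0, L[, forall x : R,
          is_derive x 1 (D i) (D i.+1 x)}].

(* phi \in C_c^oo(0, L) *)
Definition test_function phi : Prop :=
  [/\ forall k x, derivable (derive1n k phi) x 1,
      compact (closure [set x | phi x != 0]) &
      closure [set x | phi x != 0] `<=` `]0, L[].

Definition L2 f : Prop :=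
  f \_ `]0, L[ \in Lfun (@lebesgue_measure R) 2%:E.

Definition weak_derivative f g : Prop :=
  forall phi, test_function phi ->
    \int[lebesgue_measure]_(x in `]0, L[) (f x * derive1 phi x) =
    - \int[lebesgue_measure]_(x in `]0, L[) (g x * phi x).

(* Elements of H^2(0, L) are identified with their C^1[0, L] representative
   (Sobolev embedding), so that u(0), u(L), u_x(0), u_x(L) make sense. *)
Definition H2 u : Prop :=
  exists u1 u2 : R -> R,
    [/\ [/\ L2 u, L2 u1 & L2 u2],
        weak_derivative u u1, weak_derivative u1 u2,
        {within `[0, L], continuous u} & {within `[0, L], continuous u1}].

(* u_x: the weak derivative of u that is continuous on [0, L]; for u in H^2
   it exists and is unique on [0, L]. *)
Definition dx u : R -> R :=
  xget (cst 0) [set g | {within `[0, L], continuous g} /\ weak_derivative u g].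

(* u_xx: a representative of the weak derivative of u_x in L^2(0, L); for u in
   H^2 it exists and is unique up to a null set. *)
Definition dxx u : R -> R :=
  xget (cst 0) [set g | L2 g /\ weak_derivative (dx u) g].

Definition H20 u : Prop := [/\ H2 u, u 0 = 0 & dx u 0 = 0].

Definition is_subspace (W : set (R -> R)) : Prop :=
  [/\ W `<=` [set u | H20 u], W (cst 0) &
      forall (a : R) u v, W u -> W v -> W (fun x => a * u x + v x)].

Definition has_coords (N : nat) (w : 'I_N -> R -> R) u (U : 'cV[R]_N) : Prop :=
  {in `[0, L], forall x, u x = \sum_(j < N) U j 0 * w j x}.

Definition is_basis (W : set (R -> R)) (N : nat) (w : 'I_N -> R -> R) : Prop :=
  [/\ forall j, W (w j),
      forall U : 'cV[R]_N, has_coords w (cst 0) U -> U = 0 &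
      forall u, W u -> exists U : 'cV[R]_N, has_coords w u U].

End FunctionSpaces.

Section Controllers.
Variables (R : realType) (r : nat).

Definition dotv (K : pzRingType) (m : nat) (x y : 'cV[K]_m) : K :=
  (x^T *m y) 0 0.

Definition quad (P : 'M[R]_r) (x : 'cV[R]_r) : R := (x^T *m P *m x) 0 0.

Record controller := Controller {
  cA : 'M[R]_r; cb : 'cV[R]_r; cc : 'cV[R]_r; cd : R; cdelta : R;
  cP : 'M[R]_r; ceps : R; cq : 'cV[R]_r }.

Definition tdelta (C : controller) : R := Num.sqrt (2 * (cd C - cdelta C)).

Definition hurwitz (A : 'M[R]_r) : Prop :=
  forall l : R[i], eigenvalue (map_mx (real_complex R) A) l -> complex.Re l < 0.

Definition transfer (C : controller) (s : R[i]) : R[i] :=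
  dotv (invmx (s%:M - map_mx (real_complex R) (cA C))
          *m map_mx (real_complex R) (cb C))
       (map_mx (real_complex R) (cc C)) + (cd C)%:C.

Definition sym_posdef (P : 'M[R]_r) : Prop :=
  P^T = P /\ forall x : 'cV[R]_r, x != 0 -> 0 < quad P x.

Definition controller_ok (C : controller) : Prop :=
  [/\ hurwitz (cA C),
      forall om : R, 0 <= om -> cd C <= complex.Re (transfer C (0 +i* om)),
      cdelta C <= cd C & 0 < cdelta C] /\
  [/\ sym_posdef (cP C), 0 < ceps C,
      cP C *m cA C + (cA C)^T *m cP C
        = - (cq C *m (cq C)^T) - ceps C *: cP C &
      cP C *m cb C = cc C - tdelta C *: cq C].

End Controllers.

Section Scheme.
Variables (R : realType) (r : nat).

Record beam := Beam {
  bL : R; bM : R; bJ : R; bk1 : R; bk2 : R; bmu : R -> R; bLam : R -> R }.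

Definition beam_ok (p : beam) : Prop :=
  [/\ 0 < bL p, [/\ 0 < bM p, 0 < bJ p, 0 < bk1 p & 0 < bk2 p],
      Ck_itv (bL p) 4 (bmu p) /\ {in `[0, bL p], forall x, 0 < bmu p x} &
      Ck_itv (bL p) 4 (bLam p) /\ {in `[0, bL p], forall x, 0 < bLam p x}].

(* z = [u v zeta_1 zeta_2]^T *)
Record state := State {
  su : R -> R; sv : R -> R; szeta1 : 'cV[R]_r; szeta2 : 'cV[R]_r }.

Variables (p : beam) (C1 C2 : controller R r).
Let L := bL p.

(* ||z||^2 *)
Definition sqnorm (z : state) : R :=
  2^-1 * (\int[lebesgue_measure]_(x in `[0%R, L])
            (bLam p x * dxx L (su z) x ^+ 2))
  + 2^-1 * (\int[lebesgue_measure]_(x in `[0%R, L]) (bmu p x * sv z x ^+ 2))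
  + bM p / 2 * sv z L ^+ 2
  + bJ p / 2 * dx L (sv z) L ^+ 2
  + bk1 p / 2 * dx L (su z) L ^+ 2
  + bk2 p / 2 * su z L ^+ 2
  + 2^-1 * quad (cP C1) (szeta1 z)
  + 2^-1 * quad (cP C2) (szeta2 z).

Variables (N : nat) (w : 'I_N -> R -> R).

Definition massA : 'M[R]_N := \matrix_(i, j)
  (\int[lebesgue_measure]_(x in `[0%R, L]) (bmu p x * w i x * w j x)
   + bM p * w i L * w j L + bJ p * dx L (w i) L * dx L (w j) L).

Definition dampB : 'M[R]_N := \matrix_(i, j)
  (cd C1 * dx L (w i) L * dx L (w j) L + cd C2 * w i L * w j L).

Definition stiffK : 'M[R]_N := \matrix_(i, j)
  (\int[lebesgue_measure]_(x in `[0%R, L])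
      (bLam p x * dxx L (w i) x * dxx L (w j) x)
   + bk1 p * dx L (w i) L * dx L (w j) L + bk2 p * w i L * w j L).

Definition couplC (z : state) : 'cV[R]_N := \col_j
  (dotv (cc C1) (szeta1 z) * dx L (w j) L + dotv (cc C2) (szeta2 z) * w j L).

(* One Crank-Nicolson step from z to z', with coefficient vectors U, V of
   u, v and U', V' of u', v' in the basis w. *)
Definition CN_step (dt : R) (z : state) (U V : 'cV[R]_N)
    (z' : state) (U' V' : 'cV[R]_N) : Prop :=
  [/\ dt^-1 *: (U' - U) = 2^-1 *: (V' + V),
      dt^-1 *: (massA *m V' - massA *m V)
        = - (2^-1 *: (stiffK *m U' + stiffK *m U))
          - 2^-1 *: (dampB *m V' + dampB *m V)
          - 2^-1 *: (couplC z' + couplC z),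
      dt^-1 *: (szeta1 z' - szeta1 z)
        = cA C1 *m (2^-1 *: (szeta1 z' + szeta1 z))
          + ((dx L (sv z') L + dx L (sv z) L) / 2) *: cb C1 &
      dt^-1 *: (szeta2 z' - szeta2 z)
        = cA C2 *m (2^-1 *: (szeta2 z' + szeta2 z))
          + ((sv z' L + sv z L) / 2) *: cb C2].

Definition CN_solution (W : set (R -> R)) (dt : R) (z : nat -> state)
    (U V : nat -> 'cV[R]_N) : Prop :=
  forall n : nat,
    [/\ W (su (z n)), W (sv (z n)),
        has_coords L w (su (z n)) (U n), has_coords L w (sv (z n)) (V n) &
        CN_step dt (z n) (U n) (V n) (z n.+1) (U n.+1) (V n.+1)].

End Scheme.

(* Main.v *)
Require Import Defs.
From HB Require Import structures.
From mathcomp Require Import all_boot all_order all_algebra.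
From mathcomp Require Import all_classical all_reals all_analysis.
From mathcomp Require Import measurable_realfun ring lra.
Import Order.TTheory GRing.Theory Num.Theory.
Import numFieldNormedType.Exports.
Local Open Scope classical_set_scope.
Local Open Scope ring_scope.

(** Write U, V for the coordinates of u, v in the basis w.  The squared norm is
    one half of the sum of the quadratic forms of the stiffness matrix K at U,
    of the mass matrix A at V, and of P_j at zeta_j.  For a symmetric matrix S,
    the difference of the forms at x and y is the pairing of x + y with
    S (x - y) [quad_diff], and the Crank-Nicolson step gives the
    increments x - y as dt times the right-hand side at the midpoint.  Hence,
    at midpoints:
    - the K and A parts change by - dt (V.BV + V.C), the exchange between
      kinetic and elastic energy cancelling because K is symmetric
      [midpoint_secondorder];
    - the controller part changes by
      dt (c.zeta s - (q.zeta)^2 / 2 - tdelta (q.zeta) s - eps/2 zeta.P zeta),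
      s being the controller input, by the two Kalman-Yakubovich-Popov
      equations [midpoint_controller].
    In the sum the terms c.zeta s cancel against V.C, and since
    tdelta^2 / 2 = d - delta, what is left of - d s^2 is the dissipation in the
    statement, with s the difference quotient of u_x(L) or u(L) because the
    first scheme equation makes the midpoint of V equal to the difference
    quotient of U.

    The analytic content is that the norm really is a quadratic form in U and V
    [sqnorm_quad].  The functions u_x and u_xx are chosen arbitrarily among
    weak derivatives of u, so their linearity in the coordinates is a
    uniqueness statement: a function g integrable on ]0, L[ and orthogonal to
    all test functions vanishes almost everywhere, and everywhere on [0, L] if
    it is continuous (du Bois-Reymond).  To see this, let test functions of
    the form exp (- 1 / (c (x - a) (b - x))) increase to the indicator
    function of ]a, b[ as c goes to infinity; dominated convergence gives a
    zero integral of g over every ]a, b[, and differentiating the primitive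
    of g gives g = 0. *)

Set Implicit Arguments.
Unset Strict Implicit.

(** * Smooth functions supported in an interval *)

Section Bump.
Variable R : realType.
Implicit Types (q P : {poly R}) (m : nat) (x : R).

(** With P and m arbitrary, this family contains exp (- 1 / q) (P = 1, m = 0)
    and is closed under differentiation, so that all its members are
    smooth. *)
Definition exp_bump q P m x : R :=
  if 0 < q.[x] then P.[x] / q.[x] ^+ m * expR (- q.[x]^-1) else 0.

(** Comes from the term of degree m + 2 of the exponential series at 1 / t.
    The square on the right makes exp_bump negligible, together with its
    difference quotients, at the zeros of q. *)
Lemma expRV_bound m (t : R) : 0 < t ->
  (t ^+ m)^-1 * expR (- t^-1) <= (m.+2)`!%:R * t ^+ 2.
Proof.
move=> t0; have := @expR_ge1Dxn R t^-1 m.+1 (ltW (_ : 0 < t^-1)).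
rewrite invr_gt0 => /(_ t0) h.
have ht : t ^- m.+2 / (m.+2)`!%:R <= expR t^-1.
  by rewrite -exprVn (le_trans _ h)// lerDr.
rewrite expRN ler_pdivrMr ?expR_gt0//.
apply: (@le_trans _ _ ((m.+2)`!%:R * t ^+ 2 * (t ^- m.+2 / (m.+2)`!%:R))).
  rewrite le_eqVlt; apply/orP; left; apply/eqP.
  have fn0 : (m.+2)`!%:R != 0 :> R by rewrite pnatr_eq0 -lt0n fact_gt0.
  have tn0 : t != 0 by rewrite gt_eqF.
  have -> : t ^+ m.+2 = t ^+ m * t ^+ 2 by rewrite -exprD addn2.
  by field; rewrite fn0 expf_neq0// tn0.
by rewrite ler_wpM2l// mulr_ge0// exprn_ge0// ltW.
Qed.

Lemma is_derive_dominated (f G : R -> R) x : (forall y, `|f y| <= `|G y|) ->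
  G x = 0 -> is_derive x 1 G 0 -> is_derive x 1 f 0.
Proof.
move=> fG Gx0 dG.
have fx0 : f x = 0 by apply/eqP; rewrite -normr_le0 (le_trans (fG x))// Gx0 normr0.
suff cv : h^-1 *: (f (h *: (1 : R) + x) - f x) @[h --> (0:R)^'] --> (0 : R).
  apply: DeriveDef; first by apply/cvg_ex; exists 0; exact: cv.
  by apply: cvg_lim => //; exact: cv.
have dG' : h^-1 *: ((G \o shift x) (h *: (1 : R)) - G x) @[h --> (0:R)^'] -->
    (0 : R).
  by have [dG1 dG0] := dG; rewrite -[X in _ --> X]dG0; exact: dG1.
apply/norm_cvg0P.
have /cvg_norm := dG'; rewrite normr0 => dG''.
apply: (squeeze_cvgr _ (cvg_cst 0) dG''); apply: nearW => h.
rewrite normr_ge0/= !normrZ fx0 Gx0 !subr0.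
by rewrite ler_wpM2l.
Qed.

Definition exp_bump_deriv q P m : {poly R} :=
  P^`() * q ^+ 2 - m%:R *: (P * q^`() * q) + P * q^`().

(** The only delicate points are the zeros of q: there the function is dominated
    by a multiple of (1 + P^2) q^2, a polynomial with a double zero; 1 + P^2
    bounds the absolute value of P, which is not a polynomial. *)
Lemma is_derive_exp_bump q P m x :
  is_derive x 1 (exp_bump q P m) (exp_bump q (exp_bump_deriv q P m) m.+2 x).
Proof.
have cq := @continuous_horner _ q x.
set d := exp_bump _ _ _ x.
have [qx|qx|qx] := ltgtP q.[x] 0.
- have -> : d = 0 by rewrite /d /exp_bump ltNge (ltW qx).
  apply: (@near_eq_is_derive _ _ _ (cst 0)) => //.
    near=> y; rewrite /exp_bump ltNge (ltW (_ : q.[y] < 0))//.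
    by near: y; exact: (cvgr_lt _ cq).
- apply: (@near_eq_is_derive _ _ _
      (fun y => P.[y] * ((q ^+ m).[y])^-1 * expR (- q.[y]^-1))) => //.
    near=> y; rewrite /exp_bump horner_exp ifT//.
    by near: y; exact: (cvgr_gt _ cq).
  have qn0 : q.[x] != 0 by rewrite gt_eqF.
  have qmn0 : (q ^+ m).[x] != 0 by rewrite horner_exp expf_neq0.
  have dE := @is_derive1_comp R expR (fun y => - q.[y]^-1) x _ _
    (is_derive_expR (- q.[x]^-1))
    (is_deriveN (is_deriveV qn0 (is_derive_poly q x))).
  have := is_deriveM (is_deriveM (is_derive_poly P x)
    (is_deriveV qmn0 (is_derive_poly (q ^+ m) x))) dE.
  move/trigger_derive => /(_ d) H; apply: H.
  rewrite /d /exp_bump qx /exp_bump_deriv /GRing.scale/= mulrfctE deriv_exp.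
  rewrite !(hornerD, hornerN, hornerM, hornerMn, hornerZ, horner_exp).
  case: m {d qmn0} => [|m]; first by field.
  by rewrite /= -mulr_natl !exprS; field; rewrite expf_neq0 qn0.
- have -> : d = 0 by rewrite /d /exp_bump qx ltxx.
  pose G := (m.+2)`!%:R *: ((1%:P + P ^+ 2) * q ^+ 2).
  apply: (@is_derive_dominated _ (horner G)); last 2 first.
  + by rewrite /G hornerZ hornerM horner_exp qx expr0n/= !mulr0.
  + have /trigger_derive := is_derive_poly G x; apply.
    rewrite /G derivZ derivM deriv_exp.
    by rewrite !(hornerZ, hornerD, hornerM, hornerMn, horner_exp) qx/=; ring.
  move=> y; rewrite /exp_bump; case: ifPn => [qy|_]; last by rewrite normr0.
  rewrite -mulrA normrM [X in _ * X]ger0_norm; last first.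
    by rewrite mulr_ge0// ?expR_ge0// invr_ge0 exprn_ge0// ltW.
  rewrite [X in _ <= X]ger0_norm; last first.
    rewrite /G hornerZ hornerM horner_exp hornerD hornerC horner_exp.
    by rewrite mulr_ge0// mulr_ge0 ?sqr_ge0 ?addr_ge0 ?ler01 ?sqr_ge0.
  apply: (le_trans (ler_wpM2l (normr_ge0 _) (expRV_bound _ qy))).
  rewrite /G hornerZ hornerM !horner_exp hornerD hornerC horner_exp.
  rewrite mulrCA ler_wpM2l// ler_wpM2r ?sqr_ge0// -[P.[y] ^+ 2]real_normK ?num_real//.
  by have := sqr_ge0 (`|P.[y]| - 2^-1); rewrite sqrrB; lra.
Unshelve. all: by end_near.
Qed.

Definition itv_poly (a b c : R) : {poly R} := c *: (('X - a%:P) * (b%:P - 'X)).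

Lemma horner_itv_poly a b c x :
  (itv_poly a b c).[x] = c * ((x - a) * (b - x)).
Proof. by rewrite /itv_poly !hornerE. Qed.

Definition itv_bump (a b c : R) : R -> R := exp_bump (itv_poly a b c) 1%:P 0.

Lemma itv_bumpE (a b c x : R) : a < b -> 0 < c -> itv_bump a b c x =
  if x \in `]a, b[ then expR (- (c * ((x - a) * (b - x)))^-1) else 0.
Proof.
move=> ab c0; rewrite /itv_bump /exp_bump horner_itv_poly pmulr_rgt0// in_itv/=.
rewrite hornerC expr0 divr1 mul1r.
suff -> : (0 < (x - a) * (b - x)) = (a < x < b) by [].
apply/idP/andP => [h|[ax xb]]; last by rewrite mulr_gt0// subr_gt0.
by split; nra.
Qed.

Lemma test_function_itv_bump (L a b c : R) : 0 < a -> a < b -> b < L -> 0 < c ->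
  test_function L (itv_bump a b c).
Proof.
move=> a0 ab bL c0.
have supp : [set x | itv_bump a b c x != 0] `<=` `[a, b].
  move=> x/=; rewrite /itv_bump /exp_bump horner_itv_poly.
  case: ifPn => [+ _|_]; last by rewrite eqxx.
  rewrite pmulr_rgt0// in_itv/= => h.
  by nra.
have csupp : closure [set x | itv_bump a b c x != 0] `<=` `[a, b].
  by rewrite closureE; apply: smallest_sub => //; exact: interval_closed.
split.
- move=> k x.
  suff [P [m ->]] : exists P m, derive1n k (itv_bump a b c) = exp_bump (itv_poly a b c) P m.
    by have [] := is_derive_exp_bump (itv_poly a b c) P m x.
  elim: k => [|k [P [m IH]]]; first by exists 1%:P, 0%N.
  exists (exp_bump_deriv (itv_poly a b c) P m), m.+2.
  rewrite derive1nS IH; apply/funext => y; rewrite derive1E.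
  by have [_] := is_derive_exp_bump (itv_poly a b c) P m y.
- by apply: (subclosed_compact _ (@segment_compact _ a b)) => //; exact: closed_closure.
- move=> x /csupp; rewrite /= !in_itv/= => /andP[ax xb].
  by rewrite (lt_le_trans a0)// (le_lt_trans xb).
Qed.
End Bump.

(** * The fundamental lemma of the calculus of variations *)

Section DuBoisReymond.
Variables (R : realType) (L : R).
Notation mu := (@lebesgue_measure R).

(** These functions stay in [0, 1], so this pointwise convergence is dominated
    when they are multiplied by a fixed integrable function. *)
Lemma cvg_itv_bump (a b x : R) : a < b ->
  itv_bump a b n.+1%:R x @[n --> \oo] --> (\1_(`]a, b[) x : R).
Proof.
move=> ab.
have -> : (fun n => itv_bump a b n.+1%:R x) = (fun n => if x \in `]a, b[
    then expR (- (n.+1%:R^-1 * ((x - a) * (b - x))^-1)) else 0).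
  by apply/funext => n; rewrite itv_bumpE// invfM.
rewrite indicE mem_setE; case: (x \in _); last exact: cvg_cst.
rewrite -[X in _ --> X]expR0 -[X in expR X]oppr0 -(mul0r ((x - a) * (b - x))^-1).
apply: continuous_cvg; first exact: continuous_expR.
by apply: cvgN; apply: cvgM; [exact: cvg_harmonic|exact: cvg_cst].
Qed.

Lemma itv_bump_ge0 (a b c x : R) : a < b -> 0 < c -> 0 <= itv_bump a b c x.
Proof. by move=> ab c0; rewrite itv_bumpE//; case: ifPn; rewrite ?expR_ge0. Qed.

Lemma itv_bump_le1 (a b c x : R) : a < b -> 0 < c -> itv_bump a b c x <= 1.
Proof.
move=> ab c0; rewrite itv_bumpE//; case: ifPn => //; rewrite in_itv/= => /andP[ax xb].
by rewrite expR_le1 oppr_le0 invr_ge0 ltW// mulr_gt0// mulr_gt0// subr_gt0.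
Qed.

Lemma test_function_continuous (phi : R -> R) :
  test_function L phi -> continuous phi.
Proof.
move=> [dphi _ _] x; apply/differentiable_continuous/derivable1_diffP.
exact: (dphi 0%N x).
Qed.

(** The vanishing integrals against the smooth approximations of the indicator
    function of ]a, b[ pass to the limit. *)
Lemma integral_itv_eq0 (g : R -> R) (a b : R) :
  mu.-integrable `]0, L[ (EFin \o g) ->
  (forall phi, test_function L phi ->
    \int[mu]_(x in `]0, L[) (g x * phi x) = 0) ->
  0 < a -> a < b -> b < L -> \int[mu]_(x in `]a, b[) g x = 0.
Proof.
move=> ig g0 a0 ab bL.
have mg : measurable_fun `]0, L[ g by apply/measurable_EFinP; case/integrableP: ig.
have tf n : test_function L (itv_bump a b n.+1%:R) by exact: test_function_itv_bump.
pose f_ n (x : R) := (g x * itv_bump a b n.+1%:R x)%:E.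
pose f (x : R) := (g x * \1_(`]a, b[) x)%:E.
have mt n : measurable_fun (`]0, L[ : set R) (itv_bump a b n.+1%:R).
  apply: measurable_funTS; apply: continuous_measurable_fun.
  exact: test_function_continuous (tf n).
have [] := @dominated_convergence _ _ _ mu `]0, L[ _ f_ f (abse \o (EFin \o g)).
- exact: measurable_itv.
- by move=> n; apply/measurable_EFinP; apply: measurable_funM => //; exact: mt.
- by apply/measurable_EFinP; apply: measurable_funM => //; exact: measurable_indic.
- apply: aeW => x _; apply: cvg_EFin; first by apply: nearW.
  by apply: cvgM; [exact: cvg_cst|exact: cvg_itv_bump].
- exact: integrable_abse.
- apply: aeW => x n _; rewrite /f_/= lee_fin normrM ler_piMr//.
  by rewrite ger0_norm ?itv_bump_ge0 ?itv_bump_le1.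
move=> fi _.
have -> : [sequence (\int[mu]_(x in `]0%R, L[) f_ n x)%E]_n = cst 0%E.
  apply/funext => n /=.
  have /fineK <- : (\int[mu]_(x in `]0%R, L[) f_ n x)%E \is a fin_num.
    apply: integrable_fin_num => //.
    apply: (le_integrable _ _ _ ig) => //.
      by apply/measurable_EFinP; apply: measurable_funM => //; exact: mt.
    move=> x _; rewrite /f_/= lee_fin normrM ler_piMr//.
    by rewrite ger0_norm ?itv_bump_ge0 ?itv_bump_le1.
  by rewrite -[fine _]/(Rintegral mu _ _) g0.
move=> /(cvg_unique _) /(_ (cvg_cst 0%E)) h0.
transitivity (\int[mu]_(x in `]0, L[) (g x * \1_(`]a, b[) x)); last first.
  by rewrite /Rintegral -/f h0//; exact: ereal_hausdorff.
have DE : (`]a, b[ : set R)%classic = `]0, L[ `&` `]a, b[.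
  apply/esym/setIidPr => x /=; rewrite !in_itv/= => /andP[ax xb].
  by rewrite (lt_trans a0)// (lt_trans xb).
rewrite [X in Rintegral _ X]DE Rintegral_mkcondr; apply: eq_Rintegral => x _.
by rewrite patchE indicE; case: (x \in _); rewrite ?mulr1 ?mulr0.
Qed.

Section Vanishing.
Variable g : R -> R.
Hypothesis ig : mu.-integrable `]0, L[ (EFin \o g).
Hypothesis g0 : forall phi, test_function L phi ->
  \int[mu]_(x in `]0, L[) (g x * phi x) = 0.

(* The differentiation theorems for integrals need a function on the whole
   line, hence the extension by zero. *)
Let gD := g \_ `]0, L[.

Let igD (E : set R) : measurable E -> mu.-integrable E (EFin \o gD).
Proof.
move=> mE; apply: (integrableS measurableT) => //.
rewrite /gD -restrict_EFin.
by apply: (integrable_mkcond _ _).1 => //; exact: measurable_itv.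
Qed.

Let F (y : R) := \int[mu]_(x in `]0, y]) gD x.

(* Increments of F are integrals of g over subintervals. *)
Let F_cst (x y : R) : x \in `]0, L[ -> y \in `]0, L[ -> F x = F y.
Proof.
wlog xy : x y / x < y => [hw|].
  have [xy|yx|->//] := ltgtP x y; first exact: hw.
  by move=> xL yL; apply/esym; exact: hw.
rewrite !in_itv/= => /andP[x0 xL] /andP[y0 yL].
apply/esym/eqP; rewrite -subr_eq0; apply/eqP.
rewrite Rintegral_itvB ?bnd_simp//; [|exact: igD|exact: ltW..].
rewrite -Rintegral_itv_bndo_bndc; last exact: igD.
rewrite -[RHS](integral_itv_eq0 ig g0 x0 xy yL).
apply: eq_Rintegral => t; rewrite inE/= in_itv/= => /andP[xt ty].
by rewrite /gD patchE mem_set//= in_itv/= (lt_trans x0)// (lt_trans ty).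
Qed.

Let F'0 (x : R) : x \in `]0, L[ -> derive1 F x = 0.
Proof.
move=> xD; rewrite derive1E (@near_eq_derive _ _ _ _ (cst (F x))).
  exact: derive_cst.
near=> y; apply: F_cst => //.
by near: y; exact: near_in_itvoo.
Unshelve. all: by end_near. Qed.

(** At a Lebesgue point g is the derivative of F, which is constant. *)
Lemma ae_vanishing : {ae mu, forall x, x \in `]0, L[ -> g x = 0}.
Proof.
have := lebesgue_differentiation (integrable_locally_restrict (measurable_itv _) ig).
apply: filterS; first exact: (ae_filter_ringOfSetsType mu).
move=> x lx xD.
have gx : gD x = g x by rewrite /gD patchE mem_set.
have /andP[x0 xL] : 0 < x < L by move: xD; rewrite in_itv.
have [_] := @FTC1_lebesgue_pt _ gD (BRight 0) x L xL (igD (measurable_itv _)) x0 lx.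
by rewrite -/F F'0// gx.
Qed.

(** Every interior point of continuity is a Lebesgue point; the endpoints follow
    by one-sided limits. *)
Lemma continuous_vanishing : {within `[0, L], continuous g} -> 0 < L ->
  {in `[0, L], forall x, g x = 0}.
Proof.
move=> cg L0.
have g0oo : {in `]0, L[, forall x, g x = 0}.
  move=> x xD.
  have gx : gD x = g x by rewrite /gD patchE mem_set.
  have /andP[x0 xL] : 0 < x < L by move: xD; rewrite in_itv.
  have cgx : {for x, continuous gD}.
    move: cg => /(continuous_within_itvP _ L0)[cg _ _].
    rewrite /prop_for /continuous_at gx.
    have := cg x xD; rewrite /continuous_at; apply: cvg_trans.
    apply: near_eq_cvg; near=> y; rewrite /gD patchE mem_set//=.
    by near: y; exact: near_in_itvoo.
  have [_] := @continuous_FTC1 _ gD (BRight 0) x L xL (igD (measurable_itv _)) x0 cgx.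
  by rewrite -/F F'0// gx.
move: cg => /(continuous_within_itvP _ L0)[_ c0 cL].
move=> x; rewrite in_itv/= => /andP[]; rewrite le_eqVlt => /predU1P[<- _|x0].
  apply/esym; apply: (cvg_unique _ _ c0) => //.
  apply: cvg_near_cst; near=> y; apply: g0oo; rewrite in_itv/=; apply/andP; split.
    by near: y; exact: nbhs_right_gt.
  by near: y; exact: nbhs_right_lt.
rewrite le_eqVlt => /predU1P[->|xL]; last by rewrite g0oo// in_itv/= x0.
apply/esym; apply: (cvg_unique _ _ cL) => //.
apply: cvg_near_cst; near=> y; apply: g0oo; rewrite in_itv/=; apply/andP; split.
  by near: y; exact: nbhs_left_gt.
by near: y; exact: nbhs_left_lt.
Unshelve. all: by end_near. Qed.

End Vanishing.
End DuBoisReymond.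

(** * Weak derivatives and the energy integrals in coordinates *)

Section Lincomb.
Context d (T : measurableType d) (R : realType) (m : {measure set T -> \bar R}).
Variable D : set T.

Lemma Rintegral_sum (I : Type) (s : seq I) (f : I -> T -> R) :
  measurable D -> (forall i, m.-integrable D (EFin \o f i)) ->
  \int[m]_(x in D) (\sum_(i <- s) f i x) = \sum_(i <- s) \int[m]_(x in D) f i x.
Proof.
move=> mD fi; elim: s => [|i s IH].
  under eq_Rintegral do rewrite big_nil.
  by rewrite big_nil Rintegral_cst// mul0r.
under eq_Rintegral do rewrite big_cons.
rewrite big_cons RintegralD// ?IH//.
have -> : EFin \o (fun x => \sum_(j <- s) f j x)
    = (fun x => \sum_(j <- s) (EFin \o f j) x)%E.
  by apply/funext => x /=; rewrite sumEFin.
by apply: integrable_sum => // j _; exact: fi.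
Qed.

Lemma integrable_lincomb N (U : 'cV[R]_N) (f : 'I_N -> T -> R) :
  measurable D -> (forall i, m.-integrable D (EFin \o f i)) ->
  m.-integrable D (EFin \o (fun x => \sum_i U i 0 * f i x)).
Proof.
move=> mD fi.
have -> : EFin \o (fun x => \sum_i U i 0 * f i x)
    = (fun x => \sum_i ((U i 0)%:E * (EFin \o f i) x))%E.
  by apply/funext => x /=; rewrite -sumEFin; apply: eq_bigr => i _; rewrite EFinM.
by apply: integrable_sum => // j _; exact: integrableZl.
Qed.

Lemma Rintegral_lincomb N (U : 'cV[R]_N) (f : 'I_N -> T -> R) :
  measurable D -> (forall i, m.-integrable D (EFin \o f i)) ->
  \int[m]_(x in D) (\sum_i U i 0 * f i x) = \sum_i U i 0 * \int[m]_(x in D) f i x.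
Proof.
move=> mD fi; rewrite (@Rintegral_sum _ _ (fun i x => U i 0 * f i x))//; last first.
  by move=> i; apply: (integrableZl mD (U i 0) (fi i)).
by apply: eq_bigr => i _; rewrite RintegralZl.
Qed.
End Lincomb.

Section Integrability.
Variables (R : realType) (L : R).
Notation mu := (@lebesgue_measure R).
Implicit Types f g lam : R -> R.

Lemma measurable_fun_integrable (D : set R) f :
  mu.-integrable D (EFin \o f) -> measurable_fun D f.
Proof. by case/integrableP => /measurable_EFinP. Qed.

Lemma continuous_integrable_oo f : {within `[0, L], continuous f} ->
  mu.-integrable `]0, L[ (EFin \o f).
Proof.
move=> cf; apply: (@integrableS _ _ _ mu `[0, L]) => //.
- exact: subset_itv_oo_cc.
- by apply: continuous_compact_integrable => //; exact: segment_compact.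
Qed.

Lemma continuous_bounded_oo f : {within `[0, L], continuous f} ->
  [bounded f x | x in `]0, L[%classic].
Proof.
move=> cf.
have /compact_bounded[M [Mr hM]] := continuous_compact cf (@segment_compact _ 0 L).
exists M; split => // y My x xD; apply: (hM y My); exists x => //.
exact: subset_itv_oo_cc xD.
Qed.

Lemma integrable_mul_continuous f g : mu.-integrable `]0, L[ (EFin \o f) ->
  {within `[0, L], continuous g} ->
  mu.-integrable `]0, L[ (EFin \o (fun x => f x * g x)).
Proof.
move=> fi cg.
apply: (@integrableMl _ _ _ mu _ _ _ g fi) => //.
- exact: measurable_fun_integrable (continuous_integrable_oo cg).
- exact: continuous_bounded_oo.
Qed.

Lemma L2_integrable_mul f g : L2 L f -> L2 L g ->
  mu.-integrable `]0, L[ (EFin \o (fun x => f x * g x)).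
Proof.
move=> f2 g2; have /Lfun1_integrable fg := Lfun2_mul_Lfun1 f2 g2.
apply: (integrable_mkcond _ _).2; first exact: measurable_itv.
rewrite restrict_EFin; apply: eq_integrable fg => // x _ /=.
by rewrite !patchE; case: ifPn => _ //; rewrite mulr0.
Qed.

Lemma integrable_weighted_mul lam f g : {within `[0, L], continuous lam} ->
  L2 L f -> L2 L g ->
  mu.-integrable `]0, L[ (EFin \o (fun x => lam x * f x * g x)).
Proof.
move=> clam f2 g2.
have -> : (fun x => lam x * f x * g x) = (fun x => f x * g x * lam x).
  by apply/funext => x; rewrite -mulrA mulrC.
exact: integrable_mul_continuous (L2_integrable_mul f2 g2) clam.
Qed.

Lemma L2_measurable f : L2 L f -> measurable_fun `]0, L[ f.
Proof.
rewrite /L2 inE => /andP[]; rewrite inE/= => mf _.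
by apply/(measurable_restrictT _ _).2 => //; exact: measurable_itv.
Qed.

(** The interval has finite measure: |f| <= 1 + f^2. *)
Lemma L2_integrable f : L2 L f -> mu.-integrable `]0, L[ (EFin \o f).
Proof.
move=> f2; have ff := L2_integrable_mul f2 f2.
have c1 : mu.-integrable `]0, L[ (EFin \o (fun=> 1)).
  apply: continuous_integrable_oo; apply: continuous_subspaceT => x.
  exact: cvg_cst.
apply: (le_integrable _ _ _ (integrableD _ c1 ff)) => //.
- by apply/measurable_EFinP; exact: L2_measurable f2.
- move=> x _ /=; rewrite lee_fin -expr2.
  rewrite [X in _ <= X]ger0_norm ?addr_ge0 ?sqr_ge0// -real_normK ?num_real//.
  by have := sqr_ge0 (`|f x| - 2^-1); rewrite sqrrB; lra.
Qed.

Lemma Rintegral_itv_ccoo f : measurable_fun `]0, L[ f ->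
  \int[mu]_(x in `[0, L]) f x = \int[mu]_(x in `]0, L[) f x.
Proof.
by move=> mf; rewrite /Rintegral integral_itv_bndoo//; exact/measurable_EFinP.
Qed.

(** The expansion of u is only required almost everywhere because second weak
    derivatives are only determined up to null sets.  Integrability is
    required of the products, as the f_j themselves need only be square
    integrable. *)
Lemma Rintegral_weighted_sq N (U : 'cV[R]_N) (lam u : R -> R) (f : 'I_N -> R -> R) :
  (forall i j, mu.-integrable `]0, L[ (EFin \o (fun x => lam x * f i x * f j x))) ->
  measurable_fun `]0, L[ lam -> measurable_fun `]0, L[ u ->
  {ae mu, forall x, x \in `]0, L[ -> u x = \sum_j U j 0 * f j x} ->
  \int[mu]_(x in `[0, L]) (lam x * u x ^+ 2) =
  \sum_i \sum_j U i 0 * (\int[mu]_(x in `[0, L]) (lam x * f i x * f j x)) * U j 0.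
Proof.
move=> fi mlam mu_ uE.
have mD : measurable (`]0, L[ : set R) by exact: measurable_itv.
pose S x := \sum_i U i 0 * (\sum_j U j 0 * (lam x * f i x * f j x)).
have iS : mu.-integrable `]0, L[ (EFin \o S).
  by do 2 (apply: integrable_lincomb => // ?).
have mlu : measurable_fun `]0, L[ (fun x => lam x * u x ^+ 2).
  by apply: measurable_funM => //; exact: measurable_funX.
rewrite Rintegral_itv_ccoo//.
transitivity (\int[mu]_(x in `]0, L[) S x).
  congr fine; apply: ae_eq_integral => //.
  - exact/measurable_EFinP.
  - exact: measurable_int iS.
  - apply: filterS uE; first exact: (ae_filter_ringOfSetsType mu).
    move=> x + xD => /(_ xD) ->; congr EFin.
    rewrite /S expr2 mulr_suml mulr_sumr; apply: eq_bigr => i _.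
    by rewrite !mulr_sumr; apply: eq_bigr => j _; ring.
rewrite Rintegral_lincomb//; last by move=> i; apply: integrable_lincomb.
apply: eq_bigr => i _; rewrite Rintegral_lincomb// mulr_sumr; apply: eq_bigr => j _.
rewrite Rintegral_itv_ccoo; first by ring.
exact: measurable_fun_integrable.
Qed.
End Integrability.

Section WeakDerivatives.
Variables (R : realType) (L : R).
Hypothesis L0 : 0 < L.
Notation mu := (@lebesgue_measure R).
Implicit Types f g u : R -> R.

Lemma test_function_deriv_continuous (phi : R -> R) :
  test_function L phi -> continuous (derive1 phi).
Proof.
move=> [dphi _ _] x; apply/differentiable_continuous/derivable1_diffP.
exact: (dphi 1%N x).
Qed.

Lemma weak_derivative_lincomb N (U : 'cV[R]_N) (w g : 'I_N -> R -> R) u :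
  (forall j, mu.-integrable `]0, L[ (EFin \o w j)) ->
  (forall j, mu.-integrable `]0, L[ (EFin \o g j)) ->
  (forall j, weak_derivative L (w j) (g j)) ->
  {in `]0, L[, forall x, u x = \sum_j U j 0 * w j x} ->
  weak_derivative L u (fun x => \sum_j U j 0 * g j x).
Proof.
move=> wi gi wg uE phi tphi.
have mD : measurable (`]0, L[ : set R) by exact: measurable_itv.
transitivity (\int[mu]_(x in `]0, L[) (\sum_j U j 0 * (w j x * derive1 phi x))).
  apply: eq_Rintegral => x; rewrite inE/= => xD.
  by rewrite uE// mulr_suml; apply: eq_bigr => j _; rewrite mulrA.
rewrite Rintegral_lincomb//; last first.
  move=> j; apply: integrable_mul_continuous => //; apply: continuous_subspaceT.
  exact: test_function_deriv_continuous.
under eq_bigr do rewrite wg// mulrN.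
rewrite sumrN; congr (- _).
rewrite -Rintegral_lincomb//; last first.
  move=> j; apply: integrable_mul_continuous => //; apply: continuous_subspaceT.
  exact: test_function_continuous tphi.
apply: eq_Rintegral => x _.
by rewrite mulr_suml; apply: eq_bigr => j _; rewrite mulrA.
Qed.

Lemma weak_derivative_orthogonal u g1 g2 :
  mu.-integrable `]0, L[ (EFin \o g1) -> mu.-integrable `]0, L[ (EFin \o g2) ->
  weak_derivative L u g1 -> weak_derivative L u g2 ->
  forall phi, test_function L phi ->
  \int[mu]_(x in `]0, L[) ((g1 x - g2 x) * phi x) = 0.
Proof.
move=> i1 i2 w1 w2 phi tphi.
have cphi : {within `[0, L], continuous phi}.
  by apply: continuous_subspaceT; exact: test_function_continuous tphi.
under eq_Rintegral do rewrite mulrBl.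
rewrite RintegralB; [|exact: measurable_itv|exact: integrable_mul_continuous..].
by apply/eqP; rewrite subr_eq0 -eqr_opp -w1// -w2.
Qed.

Lemma weak_derivative_unique_ae u g1 g2 :
  mu.-integrable `]0, L[ (EFin \o g1) -> mu.-integrable `]0, L[ (EFin \o g2) ->
  weak_derivative L u g1 -> weak_derivative L u g2 ->
  {ae mu, forall x, x \in `]0, L[ -> g1 x = g2 x}.
Proof.
move=> i1 i2 w1 w2.
have i12 : mu.-integrable `]0, L[ (EFin \o (fun x => g1 x - g2 x)).
  exact: (integrableB _ i1 i2).
have := ae_vanishing i12 (weak_derivative_orthogonal i1 i2 w1 w2).
apply: filterS; first exact: (ae_filter_ringOfSetsType mu).
by move=> x + xD => /(_ xD) /eqP; rewrite subr_eq0 => /eqP.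
Qed.

Lemma weak_derivative_unique u g1 g2 :
  {within `[0, L], continuous g1} -> {within `[0, L], continuous g2} ->
  weak_derivative L u g1 -> weak_derivative L u g2 ->
  {in `[0, L], g1 =1 g2}.
Proof.
move=> c1 c2 w1 w2.
have [i1 i2] := (continuous_integrable_oo c1, continuous_integrable_oo c2).
have i12 : mu.-integrable `]0, L[ (EFin \o (fun x => g1 x - g2 x)).
  exact: (integrableB _ i1 i2).
have c12 : {within `[0, L], continuous (fun x => g1 x - g2 x)}.
  by move=> x; apply: cvgB; [exact: c1|exact: c2].
move=> x xL; apply/eqP; rewrite -subr_eq0; apply/eqP.
exact: (continuous_vanishing i12 (weak_derivative_orthogonal i1 i2 w1 w2)).
Qed.

Lemma dxP u : H2 L u ->
  {within `[0, L], continuous (dx L u)} /\ weak_derivative L u (dx L u).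
Proof.
move=> [u1 [u2 [_ wu1 _ _ cu1]]].
apply: (@xgetPex _ _ [set g | {within `[0, L], continuous g} /\ weak_derivative L u g]).
by exists u1.
Qed.

(** The second component of H2 is a weak derivative of some weak derivative u1
    of u; uniqueness identifies u1 with the chosen one on [0, L]. *)
Lemma dxxP u : H2 L u -> L2 L (dxx L u) /\ weak_derivative L (dx L u) (dxx L u).
Proof.
move=> hu; have [cdx wdx] := dxP hu.
move: hu => [u1 [u2 [[_ _ l2] wu1 wu2 _ cu1]]].
apply: (@xgetPex _ _ [set g | L2 L g /\ weak_derivative L (dx L u) g]).
exists u2; split => // phi tphi.
rewrite -wu2//; apply: eq_Rintegral => x; rewrite inE/= => xD; congr (_ * _).
by apply: (weak_derivative_unique cdx cu1 wdx wu1); exact: subset_itv_oo_cc xD.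
Qed.

Lemma H2_continuous u : H2 L u -> {within `[0, L], continuous u}.
Proof. by move=> [u1 [u2 []]]. Qed.

Lemma continuous_lincomb N (U : 'cV[R]_N) (w : 'I_N -> R -> R) :
  (forall j, {within `[0, L], continuous (w j)}) ->
  {within `[0, L], continuous (fun x => \sum_j U j 0 * w j x)}.
Proof.
move=> cw x.
have -> : (fun x => \sum_j U j 0 * w j x) = \sum_j (fun x => U j 0 * w j x).
  by apply/funext => y; rewrite fct_sumE.
elim/big_ind: _ => [|f g cf cg|j _]; first exact: cvg_cst.
  exact: cvgD.
by apply: cvgM; [exact: cvg_cst|exact: cw].
Qed.

Section Coordinates.
Variables (N : nat) (w : 'I_N -> R -> R) (u : R -> R) (U : 'cV[R]_N).
Hypotheses (hw : forall j, H2 L (w j)) (hu : H2 L u) (uU : has_coords L w u U).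

(** The same linear combination of the u_x of the w_j is another continuous weak
    derivative of u. *)
Lemma dx_coords : has_coords L (fun j => dx L (w j)) (dx L u) U.
Proof.
have [cu wu] := dxP hu.
apply: (weak_derivative_unique cu _ wu).
  by apply: continuous_lincomb => j; have [] := dxP (hw j).
apply: weak_derivative_lincomb.
- by move=> j; apply: continuous_integrable_oo; exact: H2_continuous.
- by move=> j; apply: continuous_integrable_oo; have [] := dxP (hw j).
- by move=> j; have [] := dxP (hw j).
- by move=> x xD; apply: uU; exact: subset_itv_oo_cc xD.
Qed.

Lemma dxx_coords :
  {ae mu, forall x, x \in `]0, L[ -> dxx L u x = \sum_j U j 0 * dxx L (w j) x}.
Proof.
have [l2u wu] := dxxP hu.
have l2w j : mu.-integrable `]0, L[ (EFin \o dxx L (w j)).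
  by apply: L2_integrable; have [] := dxxP (hw j).
apply: (weak_derivative_unique_ae (L2_integrable l2u) _ wu).
  by apply: integrable_lincomb.
apply: (@weak_derivative_lincomb _ U (fun j => dx L (w j))); [|exact: l2w|..].
- by move=> j; apply: continuous_integrable_oo; have [] := dxP (hw j).
- by move=> j; have [] := dxxP (hw j).
- by move=> x xD; apply: dx_coords; exact: subset_itv_oo_cc xD.
Qed.

Lemma integral_dxx_sq (lam : R -> R) : {within `[0, L], continuous lam} ->
  \int[mu]_(x in `[0, L]) (lam x * dxx L u x ^+ 2) =
  \sum_i \sum_j U i 0 *
    (\int[mu]_(x in `[0, L]) (lam x * dxx L (w i) x * dxx L (w j) x)) * U j 0.
Proof.
move=> clam; apply: Rintegral_weighted_sq.
- move=> i j; have [li _] := dxxP (hw i); have [lj _] := dxxP (hw j).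
  exact: integrable_weighted_mul.
- exact: measurable_fun_integrable (continuous_integrable_oo clam).
- by apply: L2_measurable; have [] := dxxP hu.
- exact: dxx_coords.
Qed.

Lemma integral_sq (lam : R -> R) : {within `[0, L], continuous lam} ->
  \int[mu]_(x in `[0, L]) (lam x * u x ^+ 2) =
  \sum_i \sum_j U i 0 *
    (\int[mu]_(x in `[0, L]) (lam x * w i x * w j x)) * U j 0.
Proof.
move=> clam; apply: Rintegral_weighted_sq.
- move=> i j; do 2 (apply: integrable_mul_continuous; last exact: H2_continuous).
  exact: continuous_integrable_oo.
- exact: measurable_fun_integrable (continuous_integrable_oo clam).
- exact: measurable_fun_integrable (continuous_integrable_oo (H2_continuous hu)).
- by apply: aeW => x xD; apply: uU; exact: subset_itv_oo_cc xD.
Qed.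

End Coordinates.

Lemma Ck_itv_continuous k f : Ck_itv L k f -> {within `[0, L], continuous f}.
Proof.
move=> [D [fD cD _]]; have {}cD := cD 0%N isT.
by apply: (subspace_eq_continuous _ cD) => x; rewrite inE/= => /fD.
Qed.
End WeakDerivatives.

(** * Quadratic forms and the midpoint rule *)

Section Forms.
Variables (R : realType) (n : nat).
Implicit Types (x y : 'cV[R]_n) (P : 'M[R]_n) (a : R).

Lemma dotvC x y : dotv x y = dotv y x.
Proof. by rewrite /dotv -[in LHS](trmxK y) -trmx_mul mxE. Qed.

Lemma dotvDl x1 x2 y : dotv (x1 + x2) y = dotv x1 y + dotv x2 y.
Proof. by rewrite /dotv linearD mulmxDl mxE. Qed.

Lemma dotvDr x y1 y2 : dotv x (y1 + y2) = dotv x y1 + dotv x y2.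
Proof. by rewrite /dotv mulmxDr mxE. Qed.

Lemma dotvNr x y : dotv x (- y) = - dotv x y.
Proof. by rewrite /dotv mulmxN mxE. Qed.

Lemma dotvZl a x y : dotv (a *: x) y = a * dotv x y.
Proof. by rewrite /dotv linearZ/= -scalemxAl mxE. Qed.

Lemma dotvZr a x y : dotv x (a *: y) = a * dotv x y.
Proof. by rewrite /dotv -scalemxAr mxE. Qed.

Lemma dotv_tr P x y : dotv x (P *m y) = dotv (P^T *m x) y.
Proof. by rewrite /dotv trmx_mul trmxK mulmxA. Qed.

Lemma dotv_sum x y : dotv x y = \sum_j x j 0 * y j 0.
Proof. by rewrite /dotv mxE; apply: eq_bigr => j _; rewrite mxE. Qed.

Lemma quad_dotv P x : quad P x = dotv x (P *m x).
Proof. by rewrite /quad /dotv mulmxA. Qed.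

Lemma quad_sum P x : quad P x = \sum_i \sum_j x i 0 * P i j * x j 0.
Proof.
rewrite quad_dotv dotv_sum; apply: eq_bigr => i _.
by rewrite mxE mulr_sumr; apply: eq_bigr => j _; rewrite mulrA.
Qed.

Lemma quad_diff P x y : P^T = P ->
  quad P x - quad P y = dotv (x + y) (P *m (x - y)).
Proof.
move=> Psym; rewrite !quad_dotv mulmxBr dotvDl !dotvDr !dotvNr.
by rewrite [dotv y (P *m x)]dotv_tr Psym [dotv (P *m y) x]dotvC; ring.
Qed.

(** Boundary terms of the Gram matrices contribute squares of point values. *)
Lemma sum_rank_one a (f : 'I_n -> R) x :
  \sum_i \sum_j x i 0 * (a * f i * f j) * x j 0 = a * (\sum_j x j 0 * f j) ^+ 2.
Proof.
rewrite expr2 mulr_suml mulr_sumr; apply: eq_bigr => i _.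
by rewrite !mulr_sumr; apply: eq_bigr => j _; ring.
Qed.

(** By symmetry of P, the pairing of x with P A x is half of the form of
    P A + A^T P. *)
Lemma lyapunov_quad (P A : 'M[R]_n) (q x : 'cV[R]_n) (e : R) : P^T = P ->
  P *m A + A^T *m P = - (q *m q^T) - e *: P ->
  2 * dotv x (P *m (A *m x)) = - dotv q x ^+ 2 - e * quad P x.
Proof.
move=> Psym lyap.
have -> : 2 * dotv x (P *m (A *m x)) = dotv x ((P *m A + A^T *m P) *m x).
  rewrite mulmxDl dotvDr -!mulmxA [X in _ + X]dotv_tr trmxK.
  by rewrite [X in _ + X]dotv_tr Psym [X in _ + X]dotvC; ring.
rewrite lyap mulmxBl mulNmx -scalemxAl dotvDr !dotvNr dotvZr -(quad_dotv P).
congr (- _ - _); rewrite -mulmxA.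
have -> : q^T *m x = (dotv q x)%:M by rewrite /dotv [LHS]mx11_scalar.
by rewrite -scalemx1 -scalemxAr mulmx1 dotvZr dotvC expr2.
Qed.

(** The Lyapunov equation of the Kalman-Yakubovich-Popov system turns the drift
    into dissipation, and its second equation replaces P b by c and q. *)
Lemma midpoint_controller (C : controller R n) (dt s : R) x y : controller_ok C ->
  dt != 0 ->
  dt^-1 *: (x - y) = cA C *m (2^-1 *: (x + y)) + s *: cb C ->
  let xm := 2^-1 *: (x + y) in
  2^-1 * quad (cP C) x - 2^-1 * quad (cP C) y =
  dt * (dotv (cc C) xm * s - 2^-1 * dotv (cq C) xm ^+ 2
        - tdelta C * dotv (cq C) xm * s - ceps C / 2 * quad (cP C) xm).
Proof.
move=> [_ [[Psym _] _ lyap Pb]] dt0 step xm.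
have xyE : x - y = dt *: (cA C *m xm + s *: cb C).
  by rewrite -step scalerA mulfV// scale1r.
have x2 : x + y = 2 *: xm by rewrite /xm scalerA mulfV ?pnatr_eq0// scale1r.
rewrite -mulrBr quad_diff// xyE x2; clearbody xm.
rewrite -scalemxAr dotvZr dotvZl mulmxDr dotvDr -scalemxAr dotvZr Pb dotvDr dotvNr dotvZr.
have := lyapunov_quad xm Psym lyap.
rewrite [dotv xm (cc C)]dotvC [dotv xm (cq C)]dotvC => lq.
have -> : dotv xm (cP C *m (cA C *m xm)) =
    2^-1 * (- dotv (cq C) xm ^+ 2 - ceps C * quad (cP C) xm).
  by rewrite -lq mulrA mulVf ?mul1r// pnatr_eq0.
by field.
Qed.

(** With Um and Vm the midpoints, the K part gains dt Um.K Vm and the A part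
    loses dt Vm.K Um, and these are equal; only B and the forcing c act on the
    total energy. *)
Lemma midpoint_secondorder (A B K : 'M[R]_n) (dt : R) (U U' V V' c : 'cV[R]_n) :
  A^T = A -> K^T = K -> dt != 0 ->
  dt^-1 *: (U' - U) = 2^-1 *: (V' + V) ->
  dt^-1 *: (A *m V' - A *m V)
    = - (2^-1 *: (K *m U' + K *m U)) - 2^-1 *: (B *m V' + B *m V) - c ->
  let Vm := 2^-1 *: (V' + V) in
  2^-1 * quad K U' + 2^-1 * quad A V' - (2^-1 * quad K U + 2^-1 * quad A V) =
  - dt * (quad B Vm + dotv Vm c).
Proof.
move=> Asym Ksym dt0 stepU stepV Vm.
have UE : U' - U = dt *: Vm by rewrite /Vm -stepU scalerA mulfV// scale1r.
pose Um := 2^-1 *: (U' + U).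
have AVE : A *m (V' - V) = dt *: (- (K *m Um) - B *m Vm - c).
  rewrite mulmxBr -[LHS]scale1r -(mulfV dt0) -scalerA stepV.
  by rewrite -!scalemxAr -!mulmxDr.
have V2 : V' + V = 2 *: Vm by rewrite /Vm scalerA mulfV ?pnatr_eq0// scale1r.
have U2 : U' + U = 2 *: Um by rewrite /Um scalerA mulfV ?pnatr_eq0// scale1r.
clearbody Um Vm.
have := quad_diff U' U Ksym; rewrite UE U2 -scalemxAr dotvZl dotvZr => dK.
have := quad_diff V' V Asym; rewrite AVE V2 dotvZl dotvZr !dotvDr !dotvNr.
rewrite [dotv Vm (K *m Um)]dotv_tr Ksym [dotv (K *m Vm) Um]dotvC -quad_dotv => dA.
rewrite opprD addrACA -!mulrBr dK dA; by field.
Qed.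
End Forms.

Section Gram.
Variables (R : realType) (L : R) (lam : R -> R) (k1 k2 : R) (N : nat).
Variables (F : 'I_N -> R -> R) (a b : 'I_N -> R).

(** Common shape of the mass matrix and of the stiffness matrix: the form of a
    weighted L2 product with two point masses at the end. *)
Definition gram : 'M[R]_N := \matrix_(i, j)
  (\int[lebesgue_measure]_(x in `[0%R, L]) (lam x * F i x * F j x)
   + k1 * a i * a j + k2 * b i * b j).

Lemma gram_sym : gram^T = gram.
Proof.
apply/matrixP => i j; rewrite !mxE; congr (_ + _ + _); first last.
- exact: mulrAC.
- exact: mulrAC.
- by apply: eq_Rintegral => x _; exact: mulrAC.
Qed.

Lemma quad_gram (U : 'cV[R]_N) : quad gram U =
  \sum_i \sum_j U i 0 *
    (\int[lebesgue_measure]_(x in `[0%R, L]) (lam x * F i x * F j x)) * U j 0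
  + k1 * (\sum_j U j 0 * a j) ^+ 2 + k2 * (\sum_j U j 0 * b j) ^+ 2.
Proof.
rewrite -!sum_rank_one -!big_split quad_sum; apply: eq_bigr => i _.
by rewrite -!big_split; apply: eq_bigr => j _; rewrite mxE/=; ring.
Qed.
End Gram.

Section Energy.
Variables (R : realType) (r : nat) (p : beam R) (C1 C2 : controller R r).
Hypothesis hp : beam_ok p.
Variables (N : nat) (w : 'I_N -> R -> R).
Hypothesis hw : forall j, H2 (bL p) (w j).

Lemma has_coords_at_end u (U : 'cV[R]_N) : has_coords (bL p) w u U ->
  u (bL p) = \sum_j U j 0 * w j (bL p).
Proof.
by have [L0 _ _ _] := hp; apply; rewrite in_itv/= lexx ltW.
Qed.

Lemma dx_at_end u (U : 'cV[R]_N) : H2 (bL p) u -> has_coords (bL p) w u U ->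
  dx (bL p) u (bL p) = \sum_j U j 0 * dx (bL p) (w j) (bL p).
Proof.
have [L0 _ _ _] := hp; move=> hu uU.
by apply: (dx_coords L0 hw hu uU); rewrite in_itv/= lexx ltW.
Qed.

Lemma massA_sym : (massA p w)^T = massA p w.
Proof. exact: gram_sym. Qed.

Lemma stiffK_sym : (stiffK p w)^T = stiffK p w.
Proof. exact: gram_sym. Qed.

Lemma quad_stiffK u U : H2 (bL p) u -> has_coords (bL p) w u U ->
  quad (stiffK p w) U =
  \int[lebesgue_measure]_(x in `[0%R, bL p]) (bLam p x * dxx (bL p) u x ^+ 2)
  + bk1 p * dx (bL p) u (bL p) ^+ 2 + bk2 p * u (bL p) ^+ 2.
Proof.
move=> hu uU; have [L0 _ _ [/Ck_itv_continuous cLam _]] := hp.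
rewrite (integral_dxx_sq L0 hw hu uU cLam) (dx_at_end hu uU) (has_coords_at_end uU).
exact: quad_gram.
Qed.

Lemma quad_massA v V : H2 (bL p) v -> has_coords (bL p) w v V ->
  quad (massA p w) V =
  \int[lebesgue_measure]_(x in `[0%R, bL p]) (bmu p x * v x ^+ 2)
  + bM p * v (bL p) ^+ 2 + bJ p * dx (bL p) v (bL p) ^+ 2.
Proof.
move=> hv vV; have [L0 _ [/Ck_itv_continuous cmu _] _] := hp.
rewrite (integral_sq hw hv vV cmu) (dx_at_end hv vV) (has_coords_at_end vV).
exact: quad_gram.
Qed.

Lemma quad_dampB V :
  quad (dampB p C1 C2 w) V =
  cd C1 * (\sum_j V j 0 * dx (bL p) (w j) (bL p)) ^+ 2
  + cd C2 * (\sum_j V j 0 * w j (bL p)) ^+ 2.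
Proof.
rewrite -!sum_rank_one -!big_split quad_sum; apply: eq_bigr => i _.
rewrite -!big_split; apply: eq_bigr => j _; rewrite mxE/=; ring.
Qed.

Lemma dotv_couplC V z :
  dotv V (couplC p C1 C2 w z) =
  dotv (cc C1) (szeta1 z) * (\sum_j V j 0 * dx (bL p) (w j) (bL p))
  + dotv (cc C2) (szeta2 z) * (\sum_j V j 0 * w j (bL p)).
Proof.
rewrite dotv_sum !mulr_sumr -big_split; apply: eq_bigr => j _.
by rewrite mxE/=; ring.
Qed.

(** The bridge between the function spaces and the linear algebra of the
    scheme: from here on only coordinates matter. *)
Lemma sqnorm_quad z U V : H2 (bL p) (su z) -> H2 (bL p) (sv z) ->
  has_coords (bL p) w (su z) U -> has_coords (bL p) w (sv z) V ->
  sqnorm p C1 C2 z = 2^-1 * quad (stiffK p w) U + 2^-1 * quad (massA p w) V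
    + 2^-1 * quad (cP C1) (szeta1 z) + 2^-1 * quad (cP C2) (szeta2 z).
Proof.
move=> hu hv uU vV; rewrite (quad_stiffK hu uU) (quad_massA hv vV) /sqnorm.
ring.
Qed.
End Energy.

(** * The discrete energy balance *)

Unset Implicit Arguments.
Set Strict Implicit.

Theorem theorem8 (R : realType) (r : nat) (r_ge1 : (1 <= r)%N)
    (p : beam R) (hp : beam_ok p)
    (C1 C2 : controller R r) (hC1 : controller_ok C1) (hC2 : controller_ok C2)
    (Wh : set (R -> R)) (hWh : is_subspace (bL p) Wh)
    (N : nat) (w : 'I_N -> R -> R) (hw : is_basis (bL p) Wh w)
    (dt : R) (dt_gt0 : 0 < dt)
    (z : nat -> state R r) (U V : nat -> 'cV[R]_N)
    (hz : CN_solution p C1 C2 w Wh dt z U V) (n : nat) :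
  let L := bL p in
  let rate_ux := (dx L (su (z n.+1)) L - dx L (su (z n)) L) / dt in
  let rate_u := (su (z n.+1) L - su (z n) L) / dt in
  let zeta1 := 2^-1 *: (szeta1 (z n.+1) + szeta1 (z n)) in
  let zeta2 := 2^-1 *: (szeta2 (z n.+1) + szeta2 (z n)) in
  sqnorm p C1 C2 (z n.+1) = sqnorm p C1 C2 (z n) -
    dt * (cdelta C1 * rate_ux ^+ 2
          + 2^-1 * (dotv (cq C1) zeta1 + tdelta C1 * rate_ux) ^+ 2
          + cdelta C2 * rate_u ^+ 2
          + 2^-1 * (dotv (cq C2) zeta2 + tdelta C2 * rate_u) ^+ 2
          + ceps C1 / 2 * quad (cP C1) zeta1
          + ceps C2 / 2 * quad (cP C2) zeta2).
Proof.
move=> L rate_ux rate_u zeta1 zeta2.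
have [L0 _ _ _] := hp.
have dt0 : dt != 0 by rewrite gt_eqF.
have WH u : Wh u -> H2 L u by have [WH20 _ _] := hWh; move=> /WH20 [].
have hw2 j : H2 L (w j) by have [Ww _ _] := hw; exact: WH (Ww j).
have [/WH hu /WH hv uU vV [stepU stepV step1 step2]] := hz n.
have [/WH hu' /WH hv' uU' vV' _] := hz n.+1.
pose Vm := 2^-1 *: (V n.+1 + V n).
(* The first scheme equation: the velocity midpoint is the rate of u. *)
have UE : U n.+1 - U n = dt *: Vm.
  by rewrite /Vm -stepU scalerA mulfV// scale1r.
have sum_mid (f : 'I_N -> R) :
    (\sum_j V n.+1 j 0 * f j + \sum_j V n j 0 * f j) / 2 = \sum_j Vm j 0 * f j.
  rewrite -big_split mulr_suml; apply: eq_bigr => j _ /=.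
  by rewrite /Vm !mxE; field.
have sum_rate (f : 'I_N -> R) :
    (\sum_j U n.+1 j 0 * f j - \sum_j U n j 0 * f j) / dt = \sum_j Vm j 0 * f j.
  rewrite -sumrB mulr_suml; apply: eq_bigr => j _.
  have /matrixP /(_ j 0) := UE; rewrite [LHS]mxE [(- U n) j 0]mxE [RHS]mxE => Uj.
  by rewrite -mulrBl Uj mulrAC [dt * _]mulrC mulfK.
have ruxE : rate_ux = \sum_j Vm j 0 * dx L (w j) L.
  by rewrite -sum_rate -(dx_at_end hp hw2 hu' uU') -(dx_at_end hp hw2 hu uU).
have ruE : rate_u = \sum_j Vm j 0 * w j L.
  by rewrite -sum_rate -(has_coords_at_end hp uU') -(has_coords_at_end hp uU).
(* Hence the inputs of the controllers, averages of v_x(L) and v(L), are the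
   rates of u_x(L) and u(L). *)
have s1E : (dx L (sv (z n.+1)) L + dx L (sv (z n)) L) / 2 = rate_ux.
  by rewrite ruxE -sum_mid -(dx_at_end hp hw2 hv' vV') -(dx_at_end hp hw2 hv vV).
have s2E : (sv (z n.+1) L + sv (z n) L) / 2 = rate_u.
  by rewrite ruE -sum_mid -(has_coords_at_end hp vV') -(has_coords_at_end hp vV).
rewrite s1E in step1; rewrite s2E in step2.
have e1 := midpoint_controller hC1 dt0 step1.
have e2 := midpoint_controller hC2 dt0 step2.
have eb := midpoint_secondorder (massA_sym p w) (stiffK_sym p w) dt0 stepU stepV.
rewrite (sqnorm_quad C1 C2 hp hw2 hu' hv' uU' vV').
rewrite (sqnorm_quad C1 C2 hp hw2 hu hv uU vV).
have deltaE (C : controller R r) :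
    controller_ok C -> cdelta C = cd C - tdelta C ^+ 2 / 2.
  move=> [[_ _ dd _] _]; rewrite sqr_sqrtr; first by field.
  by rewrite mulr_ge0 ?subr_ge0.
rewrite (deltaE _ hC1) (deltaE _ hC2).
move: eb; rewrite /= quad_dampB dotvZr dotvDr !dotv_couplC -/Vm -ruxE -ruE => eb.
have ccE (C : controller R r) (x y : 'cV[R]_r) :
    dotv (cc C) (2^-1 *: (x + y)) = (dotv (cc C) x + dotv (cc C) y) / 2.
  by rewrite dotvZr dotvDr mulrC.
move: eb e1 e2; rewrite /= !ccE -/zeta1 -/zeta2 => eb e1 e2.
lra.
Qed.
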